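(* Let $M \in \mathbb{R}^{n\times n}$, $q \in \mathbb{R}^n$, $T \in \mathbb{R}^{n\times k}$, and an integer $0 \le h < n$ be given. Let $\mathcal{U} = \{u \in \mathbb{R}^k : \Theta u \ge \zeta\}$ with $\Theta \in \mathbb{R}^{g\times k}$ and $\zeta \in \mathbb{R}^g$, where $\mathcal{U}$ is compact and $0 \in \operatorname{relint}(\mathcal{U})$, and let $\{v^1,\dots,v^\ell\}$ be a basis of the linear hull $\operatorname{lin}(\mathcal{U})$. For $b \in \mathbb{R}$ consider the mixed-integer linear feasibility problem $(P_b)$: find $x \in \{0,1\}^n$, $D \in \mathbb{R}^{n\times k}$, $r \in \mathbb{R}^n_{\ge 0}$, $A, C \in \mathbb{R}^{g\times n}_{\ge 0}$ such that \begin{align*} & r_i \le b x_i, && i \in [n],\\ & b(1-x_i) \ge M_{i,\cdot}\, r + q_i \ge 0, && i \in [n],\\ & b(1-x_i) \ge (M_{i,\cdot} D + T_{i,\cdot})\, v^j \ge -b(1-x_i), && i \in [n],\ j \in [\ell],\\ & \zeta^\top A_{\cdot,i} + r_i \ge 0, && i \in [n],\\ & \Theta^\top A_{\cdot,i} = D_{i,\cdot}^\top, && i \in [n],\\ & \zeta^\top C_{\cdot,i} + M_{i,\cdot}\, r + q_i \ge 0, && i \in [n],\\ & \Theta^\top C_{\cdot,i} = (M_{i,\cdot} D + T_{i,\cdot})^\top, && i \in [n],\\ & D_{[h],\cdot} = 0. \end{align*} Then for all sufficiently large $b$ (i.e., there is $b_0 \in \mathbb{R}$, depending on the data $M,q,T,\Theta,\zeta,h,v^1,\dots,v^\ell$,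 such that for all $b \ge b_0$) the following holds: if $(P_b)$ is feasible, then for every feasible point $(x,D,r,A,C)$ of $(P_b)$, $z(u) = Du + r$ is an affinely adjustable robust (AAR) solution; and if $(P_b)$ is infeasible, then no AAR solution exists.
   Context: Vector inequalities are componentwise. For $a,b\in\mathbb{R}^n$, $0 \le a \perp b \ge 0$ means $a \ge 0$, $b \ge 0$ and $a^\top b = 0$. An AAR solution of the linear complementarity problem with data $(q,M,T,\mathcal{U})$ is an affine decision rule $z(u) = Du + r$ with $D \in \mathbb{R}^{n\times k}$ and $r\in\mathbb{R}^n$ such that $$0 \le Du + r \perp MDu + Mr + q + Tu \ge 0 \quad\text{for all } u \in \mathcal{U},$$ where the first $h$ variables are non-adjustable (here-and-now), i.e., the first $h$ rows of $D$ are required to be zero. Notation: $[m] = \{1,\dots,m\}$ (and $[0]=\emptyset$); $A_{i,\cdot}$ and $A_{\cdot,i}$ denote the $i$-th row and $i$-th column of a matrix $A$; $D_{[h],\cdot}$ is the submatrix of the first $h$ rows of $D$. $\operatorname{relint}$ denotes the relative interior, and $\operatorname{lin}(\mathcal{U})$ is the linear span of $\mathcal{U}$. *)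

(* Defs.v *)
(* MathComp-Analysis, over an arbitrary [R : realType]. *)
From HB Require Import structures.
From mathcomp Require Import all_boot all_order all_algebra.
From mathcomp Require Import all_classical all_reals all_analysis.

Set Implicit Arguments.
Unset Strict Implicit.
Unset Printing Implicit Defensive.

Import Order.TTheory GRing.Theory Num.Theory.
Import numFieldNormedType.Exports.

Local Open Scope classical_set_scope.
Local Open Scope ring_scope.

Definition mxle (R : realType) (m p : nat) (A B : 'M[R]_(m, p)) : Prop :=
  forall i j, A i j <= B i j.

Definition complementary (R : realType) (n : nat) (a b : 'cV[R]_n) : Prop :=
  [/\ mxle 0 a, mxle 0 b & a^T *m b = 0].

Definition polyhedron (R : realType) (g k : nat)
    (Theta : 'M[R]_(g, k)) (zeta : 'cV[R]_g) : set 'cV[R]_k :=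
  [set u | mxle zeta (Theta *m u)].

Definition linear_hull (R : realType) (k : nat) (U : set 'cV[R]_k) :
    set 'cV[R]_k :=
  [set x | exists (m : nat) (w : 'I_m -> 'cV[R]_k) (c : 'I_m -> R),
     (forall i, U (w i)) /\ x = \sum_(i < m) c i *: w i].

Definition affine_hull (R : realType) (k : nat) (U : set 'cV[R]_k) :
    set 'cV[R]_k :=
  [set x | exists (m : nat) (w : 'I_m -> 'cV[R]_k) (c : 'I_m -> R),
     [/\ forall i, U (w i), \sum_(i < m) c i = 1
       & x = \sum_(i < m) c i *: w i]].

(* The points of U that have a neighbourhood N in R^k with
   N `&` affine_hull U `<=` U. *)
Definition relint (R : realType) (k : nat) (U : set 'cV[R]_k) :
    set 'cV[R]_k :=
  [set x | U x /\ within (affine_hull U) (nbhs x) U].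

Definition is_basis_of_hull (R : realType) (k l : nat)
    (v : l.-tuple 'cV[R]_k) (U : set 'cV[R]_k) : Prop :=
  free v /\ (forall x : 'cV[R]_k, x \in <<v>>%VS <-> linear_hull U x).

(* The non-adjustable variables are those with (0-based) index < h. *)
Definition AAR_solution (R : realType) (n k h : nat) (q : 'cV[R]_n)
    (M : 'M[R]_n) (T : 'M[R]_(n, k)) (U : set 'cV[R]_k)
    (D : 'M[R]_(n, k)) (r : 'cV[R]_n) : Prop :=
  (forall i : 'I_n, (i < h)%N -> row i D = 0) /\
  (forall u, U u ->
     complementary (D *m u + r) (M *m D *m u + M *m r + q + T *m u)).

(* The binary vector x is boolean-valued, embedded in R by (x i)%:R. *)
Record feasible (R : realType) (n k g l h : nat) (M : 'M[R]_n) (q : 'cV[R]_n)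
    (T : 'M[R]_(n, k)) (Theta : 'M[R]_(g, k)) (zeta : 'cV[R]_g)
    (v : l.-tuple 'cV[R]_k) (b : R)
    (x : {ffun 'I_n -> bool}) (D : 'M[R]_(n, k)) (r : 'cV[R]_n)
    (A C : 'M[R]_(g, n)) : Prop := Feasible {
  feasible_r_ge0 : mxle 0 r;
  feasible_A_ge0 : mxle 0 A;
  feasible_C_ge0 : mxle 0 C;
  feasible_r_le : forall i, r i 0 <= b * (x i)%:R;
  feasible_w_le : forall i,
    (row i M *m r) 0 0 + q i 0 <= b * (1 - (x i)%:R);
  feasible_w_ge0 : forall i, 0 <= (row i M *m r) 0 0 + q i 0;
  feasible_basis_le : forall i (j : 'I_l),
    ((row i M *m D + row i T) *m tnth v j) 0 0 <= b * (1 - (x i)%:R);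
  feasible_basis_ge : forall i (j : 'I_l),
    - b * (1 - (x i)%:R) <= ((row i M *m D + row i T) *m tnth v j) 0 0;
  feasible_A_zeta : forall i, 0 <= (zeta^T *m col i A) 0 0 + r i 0;
  feasible_A_Theta : forall i, Theta^T *m col i A = (row i D)^T;
  feasible_C_zeta : forall i,
    0 <= (zeta^T *m col i C) 0 0 + (row i M *m r) 0 0 + q i 0;
  feasible_C_Theta : forall i,
    Theta^T *m col i C = (row i M *m D + row i T)^T;
  feasible_D_fixed : forall i : 'I_n, (i < h)%N -> row i D = 0
}.

(* Main.v *)
(* For soundness, the columns of A and C certify, by weak LP duality, that
   Du + r and its residual are nonnegative on U, for every b. If x_i = 0, then
   r_i = 0 and the linear form D_i is nonnegative on U, hence zero on lin(U)
   because 0 is a relative interior point; if x_i = 1, the residual vanishes on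
   lin(U) by the basis constraints. For completeness no uniform bound over all
   AAR solutions is needed: if one exists, fix it, put x_i = 1 iff r_i > 0, take
   b0 large enough for this one solution, and obtain A and C from the affine
   Farkas lemma. *)
Require Import Defs.
From HB Require Import structures.
From mathcomp Require Import all_boot all_order all_algebra.
From mathcomp Require Import all_classical all_reals all_analysis.
From mathcomp Require Import lra.

Set Implicit Arguments.
Unset Strict Implicit.
Unset Printing Implicit Defensive.

Import Order.TTheory GRing.Theory Num.Theory.
Import numFieldNormedType.Exports.

Local Open Scope classical_set_scope.
Local Open Scope ring_scope.

(** * Entrywise nonnegative matrices *)

Lemma mxle0P (R : realType) (m p : nat) (A : 'M[R]_(m, p)) :
  mxle 0 A <-> forall i j, 0 <= A i j.
Proof.
by split=> A0 i j; move: (A0 i j); rewrite (mxE _ (fun=> fun=> 0)).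
Qed.

Lemma mxle0_row_mx (R : realType) (m p1 p2 : nat) (A : 'M[R]_(m, p1))
    (B : 'M[R]_(m, p2)) :
  mxle 0 A -> mxle 0 B -> mxle 0 (row_mx A B).
Proof.
move=> /mxle0P A0 /mxle0P B0; apply/mxle0P => i j.
by case: (split_ordP j) => j' ->; rewrite (row_mxEl, row_mxEr).
Qed.

Lemma mxle0_col_mx (R : realType) (m1 m2 p : nat) (A : 'M[R]_(m1, p))
    (B : 'M[R]_(m2, p)) :
  mxle 0 A -> mxle 0 B -> mxle 0 (col_mx A B).
Proof.
move=> /mxle0P A0 /mxle0P B0; apply/mxle0P => i j.
by case: (split_ordP i) => i' ->; rewrite (col_mxEu, col_mxEd).
Qed.

(** * Farkas' lemma, linear and affine *)

Section Farkas.
Variable R : realType.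

(* Induction on the number of rows (Bartl's proof): if the first constraint [a]
   is not redundant, a point [x0] violating only [a] yields the projection [P]
   onto the hyperplane [a *m x = 0] along [x0], and the induction hypothesis
   applies to the system composed with [P]. *)
Lemma farkas (m p : nat) (A : 'M[R]_(m, p)) (c : 'rV[R]_p) :
    (forall x : 'cV[R]_p, mxle 0 (A *m x) -> 0 <= (c *m x) 0 0) ->
  exists2 y : 'rV[R]_m, mxle 0 y & c = y *m A.
Proof.
elim: m A c => [|m IH] A c Ac.
  exists 0; first by move=> i j; rewrite mxE.
  rewrite mul0mx; apply/rowP => j; rewrite mxE.
  have cpos (s : R) : 0 <= c 0 j * s.
    have : 0 <= (c *m (s *: delta_mx j 0 : 'cV[R]_p)) 0 0 by apply: Ac => -[].
    by rewrite -scalemxAr -colE !mxE mulrC.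
  apply/le_anti; have := cpos 1; have := cpos (-1).
  by rewrite mulrN !mulr1 oppr_ge0 => -> ->.
rewrite -(vsubmxK (A : 'M[R]_(1 + m, p))) in Ac *.
set a := usubmx _ in Ac *; set B := dsubmx _ in Ac *.
have [Bc|/existsNP [x0 /not_implyP [Bx0 /negP]]] :=
    pselect (forall x : 'cV[R]_p, mxle 0 (B *m x) -> 0 <= (c *m x) 0 0).
  have [y y0 ->] := IH _ _ Bc; exists (row_mx (0 : 'M[R]_1) y).
    by apply: (@mxle0_row_mx R 1 1 m) => //; apply/mxle0P => i j; rewrite mxE.
  by rewrite (@mul_row_col _ 1 1 m) mul0mx add0r.
rewrite -ltNge => cx0.
have mxle_col (x : 'cV[R]_p) :
    0 <= (a *m x) 0 0 -> mxle 0 (B *m x) -> mxle 0 (col_mx a B *m x).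
  move=> ax Bx; rewrite mul_col_mx; apply: mxle0_col_mx => //.
  by apply/mxle0P => i j; rewrite !ord1.
pose s := (a *m x0) 0 0.
have s0 : s < 0.
  rewrite ltNge; apply/negP => ax0.
  by move: cx0; rewrite ltNge Ac//; exact: mxle_col.
pose P := 1%:M - s^-1 *: (x0 *m a) : 'M[R]_p.
have mulP m' (N : 'M[R]_(m', p)) : N *m P = N - s^-1 *: (N *m x0 *m a).
  by rewrite mulmxBr mulmx1 -scalemxAr mulmxA.
have aP : a *m P = 0.
  rewrite mulP [a *m x0]mx11_scalar -/s mul_scalar_mx scalerA mulVf ?lt_eqF//.
  by rewrite scale1r subrr.
have [|y y0 cP] := IH (B *m P) (c *m P).
  move=> x BPx; rewrite -mulmxA; apply: Ac; apply: mxle_col.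
    by rewrite mulmxA aP mul0mx mxE.
  by rewrite mulmxA.
(* As [c *m P = y *m B *m P], the form [c - y *m B] vanishes on the image of [P], so it is a
   multiple of [a]; evaluation at [x0] gives the factor [t]. It is nonnegative because [c *m x0] and
   [s] are negative while [y *m B *m x0] is nonnegative. *)
pose t := s^-1 * ((c - y *m B) *m x0) 0 0.
exists (row_mx (t%:M : 'M[R]_1) y).
  apply: (@mxle0_row_mx R 1 1 m) => //; apply/mxle0P => i j.
  rewrite !ord1 mxE mulr1n mulr_le0// ?invr_le0 ?ltW//.
  rewrite mulmxBl -mulmxA mxE [X in _ + X]mxE subr_lt0.
  apply: (lt_le_trans cx0); rewrite mxE sumr_ge0// => i0 _.
  by rewrite mulr_ge0//; [move/mxle0P : y0 | move/mxle0P : Bx0].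
rewrite (@mul_row_col _ 1 1 m) mul_scalar_mx /t -scalerA.
rewrite -[_ *: a]mul_scalar_mx -mx11_scalar.
move: cP; rewrite mulmxA !mulP => /(congr1 (+%R^~ (s^-1 *: (c *m x0 *m a)))).
rewrite subrK => {1}->.
by rewrite !mulmxBl scalerBr addrAC [RHS]addrC addrA.
Qed.

(** Homogenization: the linear lemma is applied to the form (c, d) on the cone of pairs (u, t) with
    Theta u >= t zeta and t >= 0. The multiplier of the row t >= 0 is the slack zeta^T y + d. *)
Lemma affine_farkas (g k : nat) (Theta : 'M[R]_(g, k)) (zeta : 'cV[R]_g)
    (c : 'rV[R]_k) (d : R) :
    polyhedron Theta zeta 0 ->
    (forall u, polyhedron Theta zeta u -> 0 <= (c *m u) 0 0 + d) ->
  exists y : 'cV[R]_g,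
    [/\ mxle 0 y, Theta^T *m y = c^T & 0 <= (zeta^T *m y) 0 0 + d].
Proof.
move=> U0 Uc.
have zeta_le0 i : zeta i 0 <= 0 by have := U0 i 0; rewrite mulmx0 mxE.
pose A := block_mx Theta (- zeta) 0 1%:M : 'M[R]_(g + 1, k + 1).
have [x|y y0 /esym] := @farkas _ _ A (row_mx c d%:M).
  rewrite -(vsubmxK x) mul_block_col mul_row_col mul0mx add0r mul1mx.
  move: (usubmx x) (dsubmx x) => {x} u t.
  rewrite (mx11_scalar t) -scalar_mxM; move: (t 0 0) => {}t /mxle0P Aut.
  have Tu i : zeta i 0 * t <= (Theta *m u) i 0.
    have := Aut (lshift 1 i) 0; rewrite col_mxEu mul_mx_scalar.
    by rewrite scalerN !mxE subr_ge0 mulrC.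
  have t0 : 0 <= t.
    by have := Aut (rshift g 0) 0; rewrite col_mxEd mxE mulr1n.
  rewrite mxE [X in _ + X]mxE mulr1n.
  (* For t = 0, u is a recession direction: if [c *m u] were negative, the multiple [s *: u], still
     in the polyhedron, would give [c] the value -(|d| + 1). For t > 0, u / t lies in the
     polyhedron. *)
  have [t_eq0|t_neq0] := eqVneq t 0.
    rewrite t_eq0 mulr0 addr0 leNgt; apply/negP => cu0.
    pose s := (`|d| + 1) / - (c *m u) 0 0.
    have s0 : 0 <= s by rewrite divr_ge0// ?oppr_ge0 ?ltW// ltr_wpDl.
    have /Uc : polyhedron Theta zeta (s *: u).
      move=> i j; rewrite ord1 -scalemxAr mxE.
      rewrite (le_trans (zeta_le0 i))// mulr_ge0//.
      by have := Tu i; rewrite t_eq0 mulr0.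
    rewrite -scalemxAr mxE /s invrN mulrN mulNr divfK ?lt_eqF//.
    by have := ler_norm d; lra.
  have t_gt0 : 0 < t by rewrite lt_def t_neq0.
  have /Uc : polyhedron Theta zeta (t^-1 *: u).
    move=> i j; rewrite ord1 -scalemxAr mxE mulrC ler_pdivlMr//.
  rewrite -scalemxAr mxE => /(mulr_ge0 t0).
  by rewrite mulrDr mulrA divff// mul1r [t * d]mulrC.
move/mxle0P : y0; rewrite -(hsubmxK y) => y0.
rewrite mul_row_block mulmx0 addr0 mulmx1.
move=> /eq_row_mx [Tc zd]; exists (lsubmx y)^T; split.
- apply/mxle0P => i j; rewrite ord1 mxE; have := y0 0 (lshift 1 i).
  by rewrite row_mxEl.
- by rewrite -trmx_mul Tc.
- have := y0 0 (rshift g 0); rewrite row_mxEr.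
  have -> : (zeta^T *m (lsubmx y)^T) 0 0 = (lsubmx y *m zeta) 0 0.
    by rewrite -trmx_mul mxE.
  move: zd => /(congr1 (fun N : 'M[R]_1 => N 0 0)).
  rewrite mulmxN mxE [X in X + _]mxE [RHS]mxE mulr1n => <-.
  by rewrite addrA subrr add0r.
Qed.

End Farkas.

(** Weak duality: pair the inequality Theta u >= zeta with y >= 0. *)
Lemma affine_farkas_sound (R : realType) (g k : nat) (Theta : 'M[R]_(g, k))
    (zeta : 'cV[R]_g) (c : 'rV[R]_k) (y : 'cV[R]_g) (u : 'cV[R]_k) :
    mxle 0 y -> Theta^T *m y = c^T -> polyhedron Theta zeta u ->
  (zeta^T *m y) 0 0 <= (c *m u) 0 0.
Proof.
move=> /mxle0P y0 /(congr1 trmx); rewrite trmx_mul !trmxK => <- Uu.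
rewrite -[zeta^T *m y]trmxK trmx_mul trmxK mxE -mulmxA !mxE.
by apply: ler_sum => i _; rewrite ler_wpM2l// mxE.
Qed.

(** * Consequences of 0 being a relative interior point *)

Lemma relint0_opp (R : realType) (k : nat) (U : set 'cV[R]_k) (u : 'cV[R]_k) :
  relint U 0 -> U u -> exists2 e : R, 0 < e & U (- e *: u).
Proof.
move=> [U0 near_U] Uu.
have near_e : \forall e \near (0 : R)^'+,
    affine_hull U (- e *: u) -> U (- e *: u).
  have : - e *: u @[e --> (0 : R)^'+] --> (0 : 'cV[R]_k).
    apply: cvg_at_right_filter.
    rewrite -(scale0r u) -[in X in _ --> X]oppr0.
    by apply: cvgZr_tmp; apply: cvgN; exact: cvg_id.
  by move=> /(_ _ near_U).
near (0 : R)^'+ => e; exists e; first by near: e; exact: nbhs_right_gt.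
suff : affine_hull U (- e *: u) by near: e.
(* The affine combination (1 + e) 0 + (-e) u. *)
exists 2, (fun i => if i == 0 then 0 else u),
  (fun i => if i == 0 then 1 + e else - e).
split.
- by move=> i; case: ifP.
- by rewrite !big_ord_recl big_ord0 /= addr0 addrK.
- by rewrite !big_ord_recl big_ord0 /= scaler0 add0r addr0.
Unshelve. all: by end_near. Qed.

(** For w in U some -e w with e > 0 is also in U, so the form is both nonnegative and nonpositive at
    w; linearity carries this to the hull. *)
Lemma ge0_linear_form_hull_eq0 (R : realType) (k : nat) (U : set 'cV[R]_k)
    (c : 'rV[R]_k) :
    relint U 0 -> (forall u, U u -> 0 <= (c *m u) 0 0) ->
  forall x, linear_hull U x -> (c *m x) 0 0 = 0.
Proof.
move=> U0 Uc x [m [w [a [Uw ->]]]]; rewrite mulmx_sumr summxE big1// => i _.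
rewrite -scalemxAr mxE; suff -> : (c *m w i) 0 0 = 0 by rewrite mulr0.
apply/le_anti; rewrite Uc// andbT.
have [e e0 /Uc] := relint0_opp U0 (Uw i).
by rewrite -scalemxAr mxE mulNr oppr_ge0 pmulr_rle0.
Qed.

Lemma sub_linear_hull (R : realType) (k : nat) (U : set 'cV[R]_k) :
  U `<=` linear_hull U.
Proof.
move=> u Uu; exists 1%N, (fun=> u), (fun=> 1); split=> //.
by rewrite big_ord1 scale1r.
Qed.

Lemma complementaryP (R : realType) (n : nat) (a b : 'cV[R]_n) :
  complementary a b <->
  forall i, [/\ 0 <= a i 0, 0 <= b i 0 & a i 0 * b i 0 = 0].
Proof.
have abE : (a^T *m b) 0 0 = \sum_i a i 0 * b i 0.
  by rewrite mxE; apply: eq_bigr => i _; rewrite mxE.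
split=> [[a0 b0 ab] i|ab].
  have a0' j : 0 <= a j 0 by move/mxle0P : a0.
  have b0' j : 0 <= b j 0 by move/mxle0P : b0.
  split=> //; move: abE; rewrite ab mxE => /esym/eqP.
  rewrite psumr_eq0 => [/allP/(_ i)|j _]; last exact: mulr_ge0.
  by rewrite mem_index_enum => /(_ isT)/eqP.
split; [| |apply/matrixP => i j; rewrite !ord1 abE mxE big1// => l _].
- by apply/mxle0P => i j; rewrite ord1; have [] := ab i.
- by apply/mxle0P => i j; rewrite ord1; have [] := ab i.
- by have [] := ab l.
Qed.

(** * Feasible points against AAR solutions *)

Section LinearComplementarity.
Variables (R : realType) (n k : nat).
Variables (M : 'M[R]_n) (q : 'cV[R]_n) (T : 'M[R]_(n, k)).
Implicit Types (D : 'M[R]_(n, k)) (r : 'cV[R]_n).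

Lemma residualE D r u i :
  (M *m D *m u + M *m r + q + T *m u) i 0 =
  ((row i M *m D + row i T) *m u) 0 0 + ((row i M *m r) 0 0 + q i 0).
Proof.
rewrite -!row_mul -raddfD -row_mul mulmxDl !mxE.
by rewrite [RHS]addrACA [_ + q i 0 in RHS]addrC addrA.
Qed.

Lemma decisionE D r u i : (D *m u + r) i 0 = (row i D *m u) 0 0 + r i 0.
Proof. by rewrite -row_mul !mxE. Qed.

Section Feasible.
Variables (g l h : nat) (Theta : 'M[R]_(g, k)) (zeta : 'cV[R]_g).
Variable v : l.-tuple 'cV[R]_k.
Let U := polyhedron Theta zeta.
Hypothesis U0 : relint U 0.
Hypothesis vU : is_basis_of_hull v U.

Lemma feasible_AAR b x D r A C :
  feasible h M q T Theta zeta v b x D r A C -> AAR_solution h q M T U D r.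
Proof.
case=> r0 A0 C0 r_le w_le w_ge0 v_le v_ge Az At Cz Ct Dh; split=> // u Uu.
have col_ge0 m p (N : 'M[R]_(m, p)) i : mxle 0 N -> mxle 0 (col i N).
  by move=> /mxle0P N0; apply/mxle0P => j i'; rewrite mxE.
have D_ge0 i u' : U u' -> 0 <= (row i D *m u') 0 0 + r i 0.
  move=> Uu'; apply: (le_trans (Az i)); rewrite lerD2r.
  exact: affine_farkas_sound (col_ge0 _ _ _ _ A0) (At i) Uu'.
apply/complementaryP => i; rewrite residualE decisionE; split.
- exact: D_ge0.
- apply: (le_trans (Cz i)); rewrite -addrA lerD2r.
  exact: affine_farkas_sound (col_ge0 _ _ _ _ C0) (Ct i) Uu.
(* [y] is the factor that vanishes: the residual if x_i = 1, the decision rule if x_i = 0. In either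
   case the relevant bounds are b times 0. *)
- have [xi|xi] := boolP (x i); [set y := (X in _ * X)|set y := (X in X * _)].
    suff -> : y = 0 by rewrite mulr0.
    have wi : (row i M *m r) 0 0 + q i 0 = 0.
      apply/le_anti; rewrite w_ge0 andbT.
      by have := w_le i; rewrite xi subrr mulr0.
    rewrite /y wi addr0.
    have : u \in <<v>>%VS by apply/vU.2; exact: sub_linear_hull.
    move=> /coord_span ->; rewrite mulmx_sumr summxE big1// => j _.
    rewrite -scalemxAr mxE (_ : (_ *m _) 0 0 = 0) ?mulr0//.
    apply/le_anti; have := v_ge i j; have := v_le i j.
    by rewrite xi subrr !mulr0 (tnth_nth 0) => -> ->.
  suff -> : y = 0 by rewrite mul0r.
  have ri : r i 0 = 0.
    apply/le_anti; have := r_le i; rewrite (negbTE xi) mulr0 => ->.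
    by move/mxle0P : r0 => /(_ i 0).
  rewrite /y ri addr0.
  apply: (ge0_linear_form_hull_eq0 U0 _ (sub_linear_hull Uu)).
  by move=> u' /(D_ge0 i); rewrite ri addr0.
Qed.

(** [D] and [r] are kept; only [x], [A] and [C] are constructed. *)
Lemma AAR_feasible D r : AAR_solution h q M T U D r ->
  exists b0, forall b, b0 <= b ->
    exists x A C, feasible h M q T Theta zeta v b x D r A C.
Proof.
move=> [Dh sol].
have {}sol i u : U u -> [/\ 0 <= (row i D *m u) 0 0 + r i 0,
    0 <= ((row i M *m D + row i T) *m u) 0 0 + ((row i M *m r) 0 0 + q i 0) &
    ((row i D *m u) 0 0 + r i 0) * (((row i M *m D + row i T) *m u) 0 0 +
    ((row i M *m r) 0 0 + q i 0)) = 0].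
  by move=> /sol/complementaryP/(_ i); rewrite residualE decisionE.
(* The case u = 0: r itself is complementary to Mr + q. *)
have sol0 i : [/\ 0 <= r i 0, 0 <= (row i M *m r) 0 0 + q i 0 &
    r i 0 * ((row i M *m r) 0 0 + q i 0) = 0].
  by have := sol i _ U0.1; rewrite !mulmx0 [(0 : 'M[R]_1) _ _]mxE !add0r.
have w_eq0 i : 0 < r i 0 -> (row i M *m r) 0 0 + q i 0 = 0.
  move=> ri; have [_ _ /eqP] := sol0 i.
  by rewrite mulf_eq0 gt_eqF//= => /eqP.
(* If r_i > 0, the constant part of the residual is zero, so its linear part is nonnegative on U. *)
have v_eq0 i j : 0 < r i 0 -> ((row i M *m D + row i T) *m tnth v j) 0 0 = 0.
  move=> ri; apply: (ge0_linear_form_hull_eq0 U0).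
    by move=> u /(sol i)[_ + _]; rewrite w_eq0// addr0.
  by apply/vU.2; apply: memv_span; exact: mem_tnth.
have [fA fAP] := choice (fun i => affine_farkas U0.1
  (fun u Uu => let: And3 p _ _ := sol i u Uu in p)).
have [fC fCP] := choice (fun i => affine_farkas U0.1
  (fun u Uu => let: And3 _ p _ := sol i u Uu in p)).
have colE (f : 'I_n -> 'cV[R]_g) i : col i (\matrix_(a, j) f j a 0) = f i.
  by apply/colP => a; rewrite !mxE.
(* The sum of all quantities that b has to bound; each is nonnegative, so [b0] dominates every one
   of them. *)
pose b0 := \sum_i (r i 0 + ((row i M *m r) 0 0 + q i 0) +
  \sum_j `|((row i M *m D + row i T) *m tnth v j) 0 0|).
exists b0 => b b0b.
have term_ge0 i : 0 <= \sum_j `|((row i M *m D + row i T) *m tnth v j) 0 0|.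
  by rewrite sumr_ge0.
have le_b i : r i 0 + ((row i M *m r) 0 0 + q i 0) +
    \sum_j `|((row i M *m D + row i T) *m tnth v j) 0 0| <= b.
  apply: le_trans b0b; rewrite /b0 (bigD1 i)//= lerDl sumr_ge0// => i' _.
  by have [? ? _] := sol0 i'; apply: addr_ge0 => //; exact: addr_ge0.
have v_le_b i j : `|((row i M *m D + row i T) *m tnth v j) 0 0| <= b.
  apply: le_trans (le_b i); have [? ? _] := sol0 i.
  rewrite (bigD1 j)//= addrCA lerDl; apply: addr_ge0; first exact: addr_ge0.
  by rewrite sumr_ge0.
exists [ffun i => 0 < r i 0].
exists (\matrix_(a, j) fA j a 0), (\matrix_(a, j) fC j a 0).
split=> //.
- by apply/mxle0P => i j; rewrite ord1; have [] := sol0 i.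
- by apply/mxle0P => a j; rewrite mxE; have [/mxle0P] := fAP j.
- by apply/mxle0P => a j; rewrite mxE; have [/mxle0P] := fCP j.
- move=> i; rewrite ffunE; have := le_b i; have := term_ge0 i.
  have [? ? _] := sol0 i.
  by case: ltP => /=; lra.
- move=> i; rewrite ffunE; have := le_b i; have := term_ge0 i.
  have [? ? _] := sol0 i.
  by case: ltP => /= [/w_eq0|_]; lra.
- by move=> i; have [] := sol0 i.
- move=> i j; rewrite ffunE; have := v_le_b i j; rewrite ler_norml => /andP[_].
  by case: ltP => /= [/v_eq0 ->|_]; lra.
- move=> i j; rewrite ffunE; have := v_le_b i j.
  rewrite ler_norml => /andP[+ _].
  by case: ltP => /= [/v_eq0 ->|_]; lra.
- by move=> i; rewrite colE; have [] := fAP i.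
- by move=> i; rewrite colE; have [] := fAP i.
- by move=> i; rewrite colE -addrA; have [] := fCP i.
- by move=> i; rewrite colE; have [] := fCP i.
Qed.

End Feasible.
End LinearComplementarity.

Theorem theorem2 (R : realType) (n k g l h : nat) (hn : (h < n)%N)
  (M : 'M[R]_n) (q : 'cV[R]_n) (T : 'M[R]_(n, k))
  (Theta : 'M[R]_(g, k)) (zeta : 'cV[R]_g)
  (v : l.-tuple 'cV[R]_k)
  (Ucompact : compact (polyhedron Theta zeta))
  (U0 : relint (polyhedron Theta zeta) 0)
  (vbasis : is_basis_of_hull v (polyhedron Theta zeta)) :
  exists b0 : R, forall b : R, b0 <= b ->
    ((exists x D r A C, feasible h M q T Theta zeta v b x D r A C) ->
       forall x D r A C, feasible h M q T Theta zeta v b x D r A C ->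
         AAR_solution h q M T (polyhedron Theta zeta) D r)
    /\
    (~ (exists x D r A C, feasible h M q T Theta zeta v b x D r A C) ->
       ~ (exists (D : 'M[R]_(n, k)) (r : 'cV[R]_n),
            AAR_solution h q M T (polyhedron Theta zeta) D r)).
Proof.
(* Without an AAR solution the infeasible case is immediate and any threshold works, here 0. With
   one, [b0] comes from that solution and makes every later problem feasible, so the infeasible case
   cannot occur. *)
have [[D [r sol]]|nosol] := pselect (exists D r,
    AAR_solution h q M T (polyhedron Theta zeta) D r); last first.
  by exists 0 => b _; split=> // _ x D r A C; exact: feasible_AAR.
have [b0 Hb0] := AAR_feasible U0 vbasis sol.
exists b0 => b /Hb0[x [A [C feas]]]; split=> [_ x' D' r' A' C'|[]].
  exact: feasible_AAR.
by exists x, D, r, A, C.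
Qed.
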